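(* Let $A$ be a Banach algebra and $I$ a closed complemented ideal in $A$. Denote by $I_0$ the closure of $\mathrm{lin}\{at-ta: a\in A,\ t\in I\}$. Suppose that $A=I\oplus X$, where $X$ is a closed subspace of $A$ such that $$xy-yx\in I_0\oplus X\quad(x,y\in X).$$ Then $I$ has the trace extension property.
   Context: Ideals are two-sided. A closed ideal $I$ of $A$ has the trace extension property if for every $\lambda\in I^*$ satisfying $a\cdot\lambda=\lambda\cdot a$ for all $a\in A$ (that is, $\lambda(ta)=\lambda(at)$ for all $t\in I$, $a\in A$) there is $\tau\in A^*$ such that $\tau|_I=\lambda$ and $\tau(ab)=\tau(ba)$ for all $a,b\in A$. *)

(* Defs.v *)
From HB Require Import structures.
From mathcomp Require Import all_boot all_order all_algebra.
From mathcomp Require Import complex.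
From mathcomp Require Import all_classical all_reals all_analysis.

Set Implicit Arguments.
Unset Strict Implicit.
Unset Printing Implicit Defensive.

Import Order.TTheory GRing.Theory Num.Theory.
Import numFieldNormedType.Exports.

Local Open Scope classical_set_scope.
Local Open Scope ring_scope.

Reserved Notation "x ** y" (at level 40, left associativity).

(* The scalars are the real or the complex numbers. *)
Variant real_or_complex (R : realType) : numFieldType -> Prop :=
  | RealScalars : real_or_complex R R
  | ComplexScalars : real_or_complex R R[i].

(* Banach algebras are not assumed to be unital, which rules out the algebra
   structures of the library (all of them extend unital rings). *)
HB.mixin Record CompleteNormedModule_isBanachAlgebra (K : numFieldType) A
    & CompleteNormedModule K A := {
  bmul : A -> A -> A ;
  bmulA : associative bmul ;
  bmulDl : left_distributive bmul +%R ;
  bmulDr : right_distributive bmul +%R ;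
  bscalerAl : forall (k : K) (x y : A), k *: bmul x y = bmul (k *: x) y ;
  bscalerAr : forall (k : K) (x y : A), k *: bmul x y = bmul x (k *: y) ;
  ler_normbM : forall x y : A, `|bmul x y| <= `|x| * `|y| }.

#[short(type="banachAlgType")]
HB.structure Definition BanachAlgebra (K : numFieldType) :=
  {A of CompleteNormedModule_isBanachAlgebra K A & CompleteNormedModule K A}.

Notation "x ** y" := (bmul x y) : ring_scope.

Section LinearSubspaces.
Context {K : numFieldType} {V : lmodType K}.
Implicit Types S T : set V.

Definition linear_subspace S :=
  S 0 /\ forall (k : K) (u v : V), S u -> S v -> S (k *: u + v).

Definition lin S : set V :=
  [set x | exists (n : nat) (k : 'I_n -> K) (v : 'I_n -> V),
    (forall i, S (v i)) /\ x = \sum_(i < n) k i *: v i].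

Definition sum_set S T : set V := [set u + v | u in S & v in T].

Definition direct_decomposition S T :=
  sum_set S T = [set: V] /\ S `&` T = [set 0].

End LinearSubspaces.

Section BanachAlgebraIdeals.
Context {K : numFieldType} {A : banachAlgType K}.
Implicit Types I S X : set A.

Definition two_sided_ideal I :=
  linear_subspace I /\ forall a t, I t -> I (a ** t) /\ I (t ** a).

Definition complemented I :=
  exists X, [/\ linear_subspace X, closed X & direct_decomposition I X].

Definition commutator_closure I : set A :=
  closure (lin [set a ** t - t ** a | a in [set: A] & t in I]).

(* lambda restricts to an element of the dual of the subspace S; the values
   of lambda outside of S are irrelevant. *)
Definition dual_on S (lambda : A -> K) :=
  (forall (k : K) (u v : A), S u -> S v ->
     lambda (k *: u + v) = k * lambda u + lambda v) /\
  {within S, continuous lambda}.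

Definition trace_extension_property I :=
  forall lambda : A -> K, dual_on I lambda ->
    (forall t a, I t -> lambda (t ** a) = lambda (a ** t)) ->
  exists tau : {linear A -> K^o},
    [/\ continuous tau,
        (forall t, I t -> tau t = lambda t) &
        (forall a b, tau (a ** b) = tau (b ** a))].

End BanachAlgebraIdeals.

(* Main.v *)
From HB Require Import structures.
Require Import Defs.
From mathcomp Require Import all_boot all_order all_algebra.
From mathcomp Require Import complex.
From mathcomp Require Import all_classical all_reals all_analysis.
From mathcomp Require Import ring.

Set Implicit Arguments.
Unset Strict Implicit.
Unset Printing Implicit Defensive.

Import Order.TTheory GRing.Theory Num.Theory.
Import numFieldNormedType.Exports.

Local Open Scope classical_set_scope.
Local Open Scope ring_scope.

(** The extension of [lambda] is [lambda \o P], with [P] the projection onto [I]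
    along [X]: continuity of [P] is an instance of the closed graph theorem, and
    the trace identity on [X] holds because [lambda], being a continuous trace,
    vanishes on [commutator_closure I]. The closed graph theorem comes from a
    Baire category argument over any archimedean [numFieldType], so that real
    and complex scalars are treated at once. *)

Lemma real_or_complex_archimedean (R : realType) (K : numFieldType) :
  real_or_complex R K -> Num.archimedean_axiom K.
Proof.
case=> x; first by exists (Num.truncn `|x|).+1; exact: truncnS_gt.
rewrite normc_def; set r := Num.sqrt _; exists (Num.truncn r).+1.
by rewrite -(rmorph_nat (real_complex R)) ltcR truncnS_gt.
Qed.

(** * Baire category and the closed graph theorem over an archimedean field *)

Section ClosedGraph.
Variable K : numFieldType.
Hypothesis archiK : Num.archimedean_axiom K.

Lemma cvg_half_expn (M : K) : 0 <= M -> M * 2^-1 ^+ n @[n --> \oo] --> (0 : K).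
Proof.
move=> M0; apply/cvgrPdist_lt => e e0.
have [N] := archiK (M / e).
have -> : `|M / e| = M / e by rewrite ger0_norm// divr_ge0// ltW.
rewrite ltr_pdivrMr// => MN.
exists N => // n /= Nn; rewrite sub0r normrN ger0_norm ?mulr_ge0 ?exprn_ge0//.
rewrite exprVn ltr_pdivrMr ?exprn_gt0// (lt_le_trans MN)// mulrC ler_wpM2l ?ltW//.
by rewrite -natrX ltr_nat (leq_ltn_trans Nn)// ltn_expl.
Qed.

(** Telescoping bounds [u m - u n] by [r n - r m], hence by [r n], which gives both the Cauchy
    property and the error estimate. It serves the nested balls of the Baire argument and the series
    in the closed graph theorem. *)
Lemma cvg_norm_sub_le (V : completeNormedModType K) (u : V^nat) (r : K^nat) :
  (forall n, 0 <= r n) -> r @ \oo --> (0 : K) ->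
  (forall n, `|u n.+1 - u n| <= r n - r n.+1) ->
  exists2 l, u @ \oo --> l & forall n, `|l - u n| <= r n.
Proof.
move=> r0 cr ur.
have dist n m : (n <= m)%N -> `|u m - u n| <= r n.
  move=> /subnK <-; suff : `|u (m - n + n)%N - u n| <= r n - r (m - n + n)%N.
    by move=> /le_trans; apply; rewrite lerBlDr lerDl.
  elim: (m - n)%N => [|k ih]; first by rewrite add0n !subrr normr0.
  rewrite addSn -(subrKA (u (k + n)%N)) (le_trans (ler_normD _ _))//.
  by rewrite addrC (le_trans (lerD ih (ur _)))// subrKA.
have /cvg_ex[l ul] : cvg (u @ \oo).
  apply/cauchy_cvgP/cauchyP => e e0.
  have [N _ rN] := (iffLR (cvgrPdist_lt _ _) cr) e e0.
  exists (u N); exists N => // m /= Nm; rewrite -ball_normE /= distrC.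
  rewrite (le_lt_trans (dist _ _ Nm))//.
  by have := rN N (leqnn N); rewrite /= sub0r normrN ger0_norm.
exists l => // n.
apply/ler_addgt0Pl => e e0.
have [N _ lN] := (iffLR (cvgrPdist_lt _ _) ul) e e0.
pose m := maxn N n.
rewrite -(subrKA (u m)) (le_trans (ler_normD _ _))// lerD//.
  by apply/ltW/lN; exact: leq_maxl.
by apply: dist; exact: leq_maxr.
Qed.

(** Baire category: if no [F n] contained a ball, shrinking closed balls, the one chosen at stage
    [n] avoiding [F n], would have a common point outside the whole cover. *)
Lemma closed_cover_interior (V : completeNormedModType K) (F : (set V)^nat) :
  (forall n, closed (F n)) -> \bigcup_n F n = setT ->
  exists n x (e : K), 0 < e /\ ball x e `<=` F n.
Proof.
move=> Fc Fcov; apply: contrapT => Fint.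
(* Pairs are a centre and a radius; [b] is an admissible successor of the ball in [a] at stage
   [a.1]. Halving both the radius and the displacement keeps the balls nested. *)
pose P (a : nat * (V * {posnum K})) (b : V * {posnum K}) :=
  [/\ b.2%:num <= a.2.2%:num / 2, `|b.1 - a.2.1| <= a.2.2%:num / 2 &
      forall z, `|z - b.1| <= b.2%:num -> ~ F a.1 z].
have [f Pf] : {f & forall a, P a (f a)}.
  apply: choice => -[n [x r]].
  have [y [xy Fy]] : exists y, ball x (r%:num / 2) y /\ ~ F n y.
    apply: contrapT => H; apply: Fint; exists n, x, (r%:num / 2); split => //.
    by move=> y xy; apply: contrapT => Fy; apply: H; exists y.
  have /nbhs_ballP[e /= e0 eF] : nbhs y (~` F n).
    by apply: open_nbhs_nbhs; split => //; exact/closed_openC/Fc.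
  have [s [s0 se sr]] : exists s : K, [/\ 0 < s, s < e & s <= r%:num / 2].
    near (0 : K)^'+ => s; exists s; split; near: s.
    - exact: nbhs_right_gt.
    - exact: nbhs_right_lt.
    - exact: nbhs_right_le.
  exists (y, PosNum s0); split => //=.
    by move: xy; rewrite -ball_normE /= distrC => /ltW.
  by move=> z zs; apply: eF; rewrite -ball_normE /= distrC (le_lt_trans zs).
pose a := fix a n := if n is p.+1 then f (p, a p) else (0, PosNum ltr01).
have aS n : P (n, a n) (a n.+1) by exact: Pf.
pose r n := (a n).2%:num.
have r0 n : 0 <= r n by rewrite /r; case: (a n) => x s; exact: ge0.
have rle n : r n <= 1 * 2^-1 ^+ n.
  elim: n => [|n ih]; first by rewrite mulr1.
  have [/le_trans + _ _] := aS n; apply.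
  by rewrite exprSr mulrA ler_wpM2r.
have cr : r @ \oo --> (0 : K).
  apply/cvgrPdist_lt => e e0.
  have [N _ HN] := (iffLR (cvgrPdist_lt _ _) (cvg_half_expn ler01)) e e0.
  exists N => // n /HN /=; rewrite !sub0r !normrN; apply: le_lt_trans.
  by rewrite !ger0_norm// (le_trans (r0 n)).
(* The radii themselves serve as error bounds: a step has length at most [r n / 2], and [r n.+1] is
   at most [r n / 2]. So the limit lies in every closed ball. *)
have [|l _ lr] := @cvg_norm_sub_le _ (fun n => (a n).1) r r0 cr.
  move=> n; have [h /le_trans + _] := aS n; apply.
  by rewrite lerBrDr [leRHS]splitr lerD2l.
have [n _ Fl] : (\bigcup_n F n) l by rewrite Fcov.
by have [_ _ /(_ l)] := aS n; apply => //; exact: lr.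
Unshelve. all: by end_near. Qed.

(** Baire puts a ball inside the closure of some [B n]; successive approximation then removes the
    closure at the cost of a factor 2 in the bound. *)
Lemma closed_graph_bounded (V W : completeNormedModType K) (T : {linear V -> W}) :
  (forall (u : V^nat) x y,
    u @ \oo --> x -> T \o u @ \oo --> y -> y = T x) ->
  exists2 C, 0 <= C & forall x, `|T x| <= C * `|x|.
Proof.
move=> Tgraph.
pose B n := [set x | `|T x| <= n%:R].
have [||n [x0 [e [e0 eB]]]] := @closed_cover_interior V (fun n => closure (B n)).
- by move=> n; exact: closed_closure.
- rewrite -subTset => x _; have [n Tn] := archiK `|T x|.
  exists n => //; apply: subset_closure; rewrite /B/=.
  by rewrite normr_id in Tn; exact: ltW.
(* Differences of points of the ball show that [B (n + n)] is dense near 0. *)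
have approx0 h d : 0 < d -> `|h| < e -> exists2 x, `|h - x| < d & `|T x| <= (n + n)%:R.
  move=> d0 he.
  have close z : ball x0 e z -> exists2 b, B n b & `|z - b| < d / 2.
    move=> /eB /(_ _ (nbhsx_ballx z (d / 2) _))[|b [Bb]]; first by rewrite divr_gt0.
    by rewrite -ball_normE; exists b.
  have [|b Bb hb] := close (x0 + h).
    by rewrite -ball_normE /= opprD addNKr normrN.
  have [c Bc hc] := close x0 (ballxx _ e0).
  exists (b - c).
    have -> : h - (b - c) = (x0 + h - b) - (x0 - c).
      by rewrite !opprB -[x0 + h - b]addrA [RHS]addrC subrKA addrCA.
    by rewrite (le_lt_trans (ler_normB _ _))// [ltRHS]splitr ltrD.
  by rewrite linearB natrD (le_trans (ler_normB _ _))// lerD.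
pose C : K := (n + n)%:R * 2 / e.
have C0 : 0 <= C by rewrite divr_ge0 ?mulr_ge0// ltW.
pose Q h x := `|h - x| <= `|h| / 2 /\ `|T x| <= C * `|h|.
have [f Pf] : {f & forall h, Q h (f h)}.
  apply: choice => h; have [->|h0] := eqVneq h 0.
    by exists 0; split; rewrite ?subr0 ?(linear0 T) !normr0 ?mul0r ?mulr0.
  (* Rescaling by [c] gives [h] the norm [e / 2], inside the range of [approx0]; dividing the bound
     [n + n] by [c] produces [C] times the norm of [h]. *)
  pose c := e / 2 / `|h|.
  have nh : 0 < `|h| by rewrite normr_gt0.
  have c0 : 0 < c by rewrite !divr_gt0.
  have [||x hx Tx] := approx0 (c *: h) (c * (`|h| / 2)).
  - by rewrite mulr_gt0// divr_gt0.
  - by rewrite normrZ gtr0_norm// divfK ?gt_eqF// ltr_pdivrMr// ltr_pMr// ltr1n.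
  exists (c^-1 *: x); split.
    have -> : h - c^-1 *: x = c^-1 *: (c *: h - x).
      by rewrite scalerBr scalerA mulVf ?gt_eqF// scale1r.
    by rewrite normrZ gtr0_norm ?invr_gt0// ler_pdivrMl// ltW.
  rewrite linearZ normrZ gtr0_norm ?invr_gt0// ler_pdivrMl// (le_trans Tx)//.
  rewrite /c /C le_eqVlt; apply/orP; left; apply/eqP; field.
  by rewrite !gt_eqF.
(* Successive approximation: [h] is the sum of the [f (g k)], whose images
   under [T] decrease geometrically. *)
exists (C * 2) => [|h]; first by rewrite mulr_ge0.
pose g k := iter k (fun x => x - f x) h.
have gle k : `|g k| <= `|h| * 2^-1 ^+ k.
  elim: k => [|k ih]; first by rewrite mulr1.
  by rewrite (le_trans (Pf _).1)// exprSr mulrA ler_wpM2r.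
pose r k := C * 2 * `|h| * 2^-1 ^+ k.
have M0 : 0 <= C * 2 * `|h| by rewrite mulr_ge0// mulr_ge0.
(* The vectors [h - g k] are the partial sums of the [f (g k)]. The factor 2 in [r] makes
   [r k - r k.+1] equal to the bound on the image of the [k]-th term. *)
have [| |k|y Ty yr] := @cvg_norm_sub_le W (fun k => T (h - g k)) r.
- by move=> k; rewrite mulr_ge0// exprn_ge0.
- exact: cvg_half_expn.
- rewrite -linearB /=.
  have -> : h - (g k - f (g k)) - (h - g k) = f (g k).
    by rewrite !opprB addrC subrKA addrC subrK.
  rewrite (le_trans (Pf _).2)// (le_trans (ler_wpM2l C0 (gle k)))//.
  by rewrite /r exprSr le_eqVlt; apply/orP; left; apply/eqP; field.
have gh : h - g k @[k --> \oo] --> h.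
  apply/cvgrPdist_lt => d d0.
  have [N _ HN] := (iffLR (cvgrPdist_lt _ _) (cvg_half_expn (normr_ge0 h))) d d0.
  exists N => // k /HN /=; rewrite sub0r normrN opprB addrC subrK; apply: le_lt_trans.
  by rewrite (le_trans (gle k))// ger0_norm// mulr_ge0// exprn_ge0.
(* The closed graph identifies [y] with [T h]; the error estimate at index 0, where the partial sum
   is 0, is the claim. *)
have <- := Tgraph _ _ _ gh Ty.
by have := yr 0; rewrite subrr linear0 subr0 /r mulr1.
Qed.

(** * The projection along a direct decomposition *)

Lemma linear_subspaceB (V : lmodType K) (S : set V) u v :
  linear_subspace S -> S u -> S v -> S (u - v).
Proof. by move=> [_ SZD] Su Sv; rewrite addrC -scaleN1r; exact: SZD. Qed.

(** The component in [I] is chosen pointwise; its uniqueness, from the trivial intersection, forces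
    linearity. *)
Lemma direct_decomposition_projection (V : lmodType K) (I X : set V) :
  linear_subspace I -> linear_subspace X -> direct_decomposition I X ->
  exists P : {linear V -> V}, forall u v, I u -> X (v - u) -> P v = u.
Proof.
move=> lI lX [IX IX0].
have [p pP] : {p & forall v, I (p v) /\ X (v - p v)}.
  apply: (@choice _ _ (fun v u => I u /\ X (v - u))) => v.
  have [u Iu [w Xw uw]] : sum_set I X v by rewrite IX.
  by exists u; split; rewrite // -uw addrC addKr.
have p_uniq u v : I u -> X (v - u) -> p v = u.
  move=> Iu Xvu; have [Ip Xp] := pP v; apply/eqP; rewrite -subr_eq0; apply/eqP.
  have : (I `&` X) (p v - u); last by rewrite IX0.
  split; first exact: linear_subspaceB.
  by have := linear_subspaceB lX Xvu Xp; rewrite opprB addrC subrKA.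
have plin : linear p.
  move=> k u v; have [[_ IZD] [_ XZD]] := (lI, lX).
  have [[Iu Xu] [Iv Xv]] := (pP u, pP v).
  apply: p_uniq; first exact: IZD.
  by rewrite opprD addrACA -scalerBr; exact: XZD.
pose P : {linear V -> V} := HB.pack p (GRing.isLinear.Build _ _ _ _ p plin).
by exists P.
Qed.

Lemma closed_decomposition_projection_continuous
    (V : completeNormedModType K) (I X : set V) (P : {linear V -> V}) :
  linear_subspace I -> linear_subspace X -> closed I -> closed X ->
  direct_decomposition I X ->
  (forall u v, I u -> X (v - u) -> P v = u) -> continuous P.
Proof.
move=> lI lX cI cX [IX _] Puniq.
have PI v : I (P v) /\ X (v - P v).
  have [u Iu [w Xw uw]] : sum_set I X v by rewrite IX.
  have Xvu : X (v - u) by rewrite -uw addrC addKr.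
  by rewrite (Puniq u).
have [|C C0 PC] := @closed_graph_bounded _ _ P.
  (* The graph is closed: [y] is a limit of points of [I] and [x - y] of points of [X], so [y] is
     the component of [x] in [I]. *)
  move=> u x y ux Py; apply/esym/Puniq.
    by apply: (closed_cvg I cI _ y Py); apply: nearW => n; exact: (PI _).1.
  apply: (closed_cvg X cX _ (x - y) (cvgB ux Py)).
  by apply: nearW => n; exact: (PI _).2.
apply: bounded_linear_continuous; apply/bounded_funP => r.
exists (C * r) => x xr.
by rewrite (le_trans (PC x))// ler_wpM2l.
Qed.

End ClosedGraph.

(** * Continuous traces on the ideal and their extension *)

Lemma continuous_comp_within (T U W : topologicalType) (S : set U)
    (f : T -> U) (g : U -> W) :
  continuous f -> (forall x, S (f x)) -> {within S, continuous g} ->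
  continuous (g \o f).
Proof.
move=> cf fS /subspace_continuousP cg x B /(cg (f x) (fS x)) /(cf x) fgB.
by apply: (@filterS _ (nbhs x) _ _ _ _ fgB) => y /=; apply; exact: fS.
Qed.

Lemma dual_on_commutator_closure0 (K : numFieldType) (A : banachAlgType K)
    (I : set A) (lambda : A -> K) :
  two_sided_ideal I -> closed I -> dual_on I lambda ->
  (forall t a, I t -> lambda (t ** a) = lambda (a ** t)) ->
  forall u, commutator_closure I u -> I u /\ lambda u = 0.
Proof.
move=> [lI idI] cI [ll cl] tl.
have lB u v : I u -> I v -> lambda (u - v) = lambda u - lambda v.
  by move=> Iu Iv; rewrite addrC -scaleN1r ll// mulN1r addrC.
have l0 : lambda 0 = 0.
  by have [I0 _] := lI; rewrite -[in LHS](subrr 0) lB// subrr.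
have lin0 u : lin [set a ** t - t ** a | a in [set: A] & t in I] u ->
    I u /\ lambda u = 0.
  move=> [n [k [v [Sv ->]]]]; elim/big_rec: _ => [|i w _ [Iw lw]].
    by split => //; have [] := lI.
  have [a _ [t It atv]] := Sv i.
  have [Iat Ita] := idI a t It.
  have Iv : I (v i) by rewrite -atv; exact: linear_subspaceB.
  split; first by have [_] := lI; exact.
  by rewrite ll// lw addr0 -atv lB// (tl t a)// subrr mulr0.
move=> u uI0.
have Iu : I u by apply: cI; apply: (closureS _ uI0) => w /lin0[].
(* If [lambda u] were nonzero, [lambda] would be nonzero at all points of [I] near [u], yet the
   span, on which it vanishes, has points arbitrarily near [u]. *)
split => //; apply/eqP; apply: contrapT => /negP lu.
have /subspace_continuousP/(_ u Iu) := cl.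
have lu0 : 0 < `|lambda u| by rewrite normr_gt0.
move=> /cvgrPdist_lt/(_ _ lu0) luw.
have [w [/lin0[Iw lw]]] := uI0 _ luw.
by move=> /(_ Iw); rewrite /from_subspace lw subr0 ltxx.
Qed.

Theorem lemma4p6 (R : realType) (K : numFieldType) (A : banachAlgType K)
    (I X : set A) :
  real_or_complex R K ->
  two_sided_ideal I -> closed I -> complemented I ->
  linear_subspace X -> closed X -> direct_decomposition I X ->
  (forall x y, X x -> X y ->
     sum_set (commutator_closure I) X (x ** y - y ** x)) ->
  trace_extension_property I.
Proof.
move=> /real_or_complex_archimedean archiK idI cI _ lX cX IX comX lambda dl tl.
have [lI IM] := idI.
have [P Puniq] := direct_decomposition_projection lI lX IX.
have Pc := closed_decomposition_projection_continuous archiK lI lX cI cX IX Puniq.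
have PI v : I (P v) /\ X (v - P v).
  have [u Iu [w Xw uw]] : sum_set I X v by rewrite IX.1.
  have Xvu : X (v - u) by rewrite -uw addrC addKr.
  by rewrite (Puniq u).
have [[I0 _] [X0 _]] := (lI, lX).
have PIid t : I t -> P t = t by move=> It; apply: Puniq => //; rewrite subrr.
have [ll cl] := dl.
have tau_lin : linear (lambda \o P : A -> K^o).
  by move=> k u v /=; rewrite linearP ll//; exact: (PI _).1.
pose tau : {linear A -> K^o} := HB.pack (lambda \o P : A -> K^o)
  (GRing.isLinear.Build _ _ _ _ (lambda \o P : A -> K^o) tau_lin).
exists tau.
have tauI t : I t -> tau t = lambda t by move=> It; rewrite /= PIid.
split => //.
  by apply: continuous_comp_within Pc _ cl => a; exact: (PI a).1.
have tau_tr t a : I t -> tau (t ** a) = tau (a ** t).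
  by move=> It; have [? ?] := IM a t It; rewrite !tauI// tl.
(* Write the commutator as [u + z] with [u] in the commutator closure and [z] in [X]: [P] kills [z],
   and [lambda] kills [u]. *)
have tauX x y : X x -> X y -> tau (x ** y) = tau (y ** x).
  move=> Xx Xy; apply/eqP; rewrite -subr_eq0 -linearB; apply/eqP.
  have [u /(dual_on_commutator_closure0 idI cI dl tl)[Iu lu] [z Xz <-]] :=
    comX x y Xx Xy.
  by rewrite /= (Puniq u)// addrC addKr.
move=> a b; have [[Ia Xa] [Ib Xb]] := (PI a, PI b).
(* Splitting both factors along the decomposition gives four products: one pair lies in [X], and the
   others involve a factor from [I]. *)
rewrite -(subrK (P a) a) -(subrK (P b) b).
move: (a - P a) (b - P b) Xa Xb => x y Xx Xy.
rewrite !(bmulDl, bmulDr) !linearD tauX// (tau_tr (P a) y)//.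
by rewrite -(tau_tr (P b) x)// (tau_tr (P a) (P b))// addrACA.
Qed.
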